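(* Let $\gamma,\kappa,\zeta>0$ and assume that the interaction rate is Gaussian, $G(u)=e^{-u^2/2}$, so that $G_\zeta(\phi)=\exp(-\phi^2/(2\zeta^2))$. Then the Gaussian functions $$F_{\sigma,\varphi}(\phi)=\frac{1}{\sqrt{2\pi}\,\sigma}\exp\left(-\frac{|\phi-\varphi|^2}{2\sigma^2}\right),\qquad \varphi\in\mathbb{R},$$ are equilibria, i.e. $Q(F_{\sigma,\varphi})=0$, provided that: (i) in the symmetric case, $\sigma=\sigma_s$ with $\displaystyle \sigma_s^2=\frac{\zeta^2}{2\left(\frac{\zeta^2}{\kappa}-1\right)}$; (ii) in the non-symmetric case, $\sigma=\sigma_a$ with $\displaystyle \sigma_a^2=\frac{\zeta^2}{\frac{2\zeta^2}{\kappa}-1}$. Therefore, Gaussian equilibria exist only for $\kappa$ such that: (i) in the symmetric case, $\kappa<\kappa_{c,s}(\zeta)=\zeta^2$; (ii) in the non-symmetric case, $\kappa<\kappa_{c,a}(\zeta)=2\zeta^2$.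
   Context: For a probability density $f$ on $\mathbb{R}$ (variable $\phi$), the Fokker-Planck operator is $$Q(f)=\gamma\,\partial_\phi\left\{\frac{(\phi G_\zeta)*f}{H(G_\zeta*f)}\,f+\frac{\kappa}{2}\,\partial_\phi\left(\frac{G_\zeta*f}{H(G_\zeta*f)}\,f\right)\right\},$$ where $G_\zeta(\phi)=G(|\phi|/\zeta)$, $*$ is convolution on $\mathbb{R}$, $\phi G_\zeta$ denotes the function $\phi\mapsto\phi\,G_\zeta(\phi)$, and $H(g)=1$ for all $g\ge0$ in the symmetric case while $H(g)=g$ for all $g\ge0$ in the non-symmetric case. *)

(* Defs.v *)
From mathcomp Require Import all_boot all_order all_algebra.
From mathcomp Require Import all_classical all_reals all_analysis.

Set Implicit Arguments.
Unset Strict Implicit.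
Unset Printing Implicit Defensive.

Import Order.TTheory GRing.Theory Num.Theory.
Import numFieldNormedType.Exports.

Local Open Scope classical_set_scope.
Local Open Scope ring_scope.

Section FokkerPlanck.
Variable R : realType.
Implicit Types (G H f g k : R -> R) (x y u phi gamma kappa zeta sigma : R).

Local Notation mu := (@lebesgue_measure R).

Definition is_density f : Prop :=
  [/\ measurable_fun [set: R] f,
      forall x, 0 <= f x
    & (\int[mu]_x (f x)%:E = 1)%E].

Definition convol k f x : R := (\int[mu]_y (k (x - y) * f y))%R.

Definition convol_defined k f : Prop :=
  forall x, mu.-integrable [set: R] (fun y => (k (x - y) * f y)%:E).

Definition rate_scale G zeta phi : R := G (`|phi| / zeta).

Definition rate_moment G zeta phi : R := phi * rate_scale G zeta phi.

Definition symmetric_case H : Prop := forall g : R, 0 <= g -> H g = 1.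

Definition nonsymmetric_case H : Prop := forall g : R, 0 <= g -> H g = g.

Definition fp_drift G H zeta f phi : R :=
  convol (rate_moment G zeta) f phi / H (convol (rate_scale G zeta) f phi)
  * f phi.

Definition fp_diffusion G H zeta f phi : R :=
  convol (rate_scale G zeta) f phi / H (convol (rate_scale G zeta) f phi)
  * f phi.

Definition fp_flux G H kappa zeta f phi : R :=
  fp_drift G H zeta f phi + kappa / 2 * derive1 (fp_diffusion G H zeta f) phi.

Definition fokker_planck G H gamma kappa zeta f phi : R :=
  gamma * derive1 (fp_flux G H kappa zeta f) phi.

(* [Rintegral], division and [derive1] are total functions; this predicate says
   that none of them takes a default value in [fokker_planck f]. *)
Definition fokker_planck_defined G H kappa zeta f : Prop :=
  [/\ convol_defined (rate_scale G zeta) f,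
      convol_defined (rate_moment G zeta) f,
      forall phi, H (convol (rate_scale G zeta) f phi) != 0,
      forall phi, derivable (fp_diffusion G H zeta f) phi 1
    & forall phi, derivable (fp_flux G H kappa zeta f) phi 1].

Definition equilibrium G H gamma kappa zeta f : Prop :=
  [/\ is_density f,
      fokker_planck_defined G H kappa zeta f
    & forall phi, fokker_planck G H gamma kappa zeta f phi = 0].

Definition gaussian_rate u : R := expR (- (u ^+ 2 / 2)).

Definition gaussian sigma (varphi : R) phi : R :=
  (Num.sqrt (2 * pi) * sigma)^-1
  * expR (- (`|phi - varphi| ^+ 2 / (2 * sigma ^+ 2))).

Lemma gaussianE sigma varphi : 0 < sigma ->
  gaussian sigma varphi = normal_pdf varphi sigma.
Proof.
move=> s0; rewrite normal_pdfE ?gt_eqF//; apply/funext => x.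
rewrite /gaussian /normal_peak /normal_fun real_normK ?num_real// -mulNr.
congr (_^-1 * _); last by rewrite [in LHS]mulr_natl.
rewrite -[in LHS](gtr0_norm s0) -sqrtr_sqr -sqrtrM ?mulr_ge0 ?pi_ge0//.
by rewrite -mulrnAr -[in RHS]mulr_natl mulrC.
Qed.

Definition sigma2_s kappa zeta : R := zeta ^+ 2 / (2 * (zeta ^+ 2 / kappa - 1)).

Definition sigma2_a kappa zeta : R := zeta ^+ 2 / (2 * zeta ^+ 2 / kappa - 1).

Definition kappa_cs zeta : R := zeta ^+ 2.

Definition kappa_ca zeta : R := 2 * zeta ^+ 2.

End FokkerPlanck.

(* Main.v *)
Require Import Defs.
From mathcomp Require Import all_boot all_order all_algebra.
From mathcomp Require Import all_classical all_reals all_analysis.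
From mathcomp Require Import measurable_realfun ring lra.
Import Order.TTheory GRing.Theory Num.Theory.
Local Open Scope ring_scope.

(** Completing the square, y |-> G_zeta(x - y) F(y) is a positive mass m(x),
    Gaussian in x with variance zeta^2 + sigma^2, times a normal density whose
    mean is an affine function of x.  Hence G_zeta * F = m and
    (phi G_zeta) * F = c (x - varphi) m  with  c = zeta^2 / (zeta^2 + sigma^2).
    In both cases the diffusion term is a bell E(x) = K exp(-b (x - varphi)^2)
    and the drift is c (x - varphi) E, so the flux is
    (c - kappa b) (x - varphi) E, whose derivative at varphi is (c - kappa b) K.
    Thus F is an equilibrium if and only if kappa b = c. *)

(** * Reflections and first moments of normal densities *)

Lemma lebesgue_measure_reflect (R : realType) (c : R) (A : set R) :
  measurable A ->
  pushforward lebesgue_measure (fun x => c - x : measurableTypeR R) A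
  = lebesgue_measure A.
Proof.
move=> mA; apply/esym/lebesgue_measure_unique => //=.
  exact: measurable_funB.
move=> mf _ [[a b]] _ <-; rewrite /pushforward/=.
(* Reflecting a half-open interval swaps its closed end but keeps its length. *)
rewrite (_ : (_ @^-1` _)%classic = `[c - b, c - a[%classic); last first.
  apply/seteqP; split => x /=; rewrite !in_itv/= => /andP[? ?];
    apply/andP; split; lra.
rewrite !lebesgue_measure_itv/= !lte_fin ltrD2l ltrN2 -!EFinD.
by rewrite (_ : c - a - (c - b) = b - a)//; ring.
Qed.

(** The reflection about [c / 2] preserves the measure, so the integral equals its own opposite. *)
Lemma Rintegral_odd (R : realType) (c : R) (f : R -> R) :
  lebesgue_measure.-integrable setT (EFin \o f) ->
  (forall x, f (c - x) = - f x) ->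
  \int[lebesgue_measure]_x f x = 0.
Proof.
move=> fi fN; pose phi (x : measurableTypeR R) : measurableTypeR R := c - x.
have mphi : measurable_fun setT phi by exact: measurable_funB.
have fphi : (EFin \o f) \o phi = (\- (EFin \o f))%E.
  by apply/funext => x /=; rewrite /phi fN.
have mf : measurable_fun setT (EFin \o f) by case/integrableP : fi.
have := integral_pushforward mphi mf (mu := lebesgue_measure) (D := setT).
rewrite preimage_setT fphi => /(_ (integrableN fi) measurableT).
move=> intE; have : (\int[lebesgue_measure]_x (EFin \o f) x
    = - \int[lebesgue_measure]_x (EFin \o f) x)%E.
  rewrite -integralN; last exact: integrable_add_def.
  rewrite -intE; apply: eq_measure_integral => A mA _.
  exact/esym/lebesgue_measure_reflect.
move=> /(congr1 fine); rewrite fineN -/(Rintegral _ _ _) => ?; lra.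
Qed.

(* The linear factor is absorbed by doubling the variance. *)
Lemma integrable_normal_moment (R : realType) (m s : R) : s != 0 ->
  lebesgue_measure.-integrable [set: R]
    (fun y => ((y - m) * normal_pdf m s y)%:E).
Proof.
move=> s0; pose s' := Num.sqrt 2 * s.
have s'0 : s' != 0 by rewrite mulf_neq0// sqrtr_eq0 -ltNge.
pose C := `|s| * normal_peak s / normal_peak s'.
apply: (@le_integrable _ _ R lebesgue_measure setT measurableT _
  (fun y : R => (C * normal_pdf m s' y)%:E)).
- apply/measurable_EFinP/measurable_funM; first exact: measurable_funB.
  exact: measurable_normal_pdf.
- move=> y _ /=.
  rewrite lee_fin normrM (ger0_norm (normal_pdf_ge0 m s y)).
  rewrite (ger0_norm (x := C * _)); last first.
    by rewrite !mulr_ge0 ?invr_ge0 ?normal_pdf_ge0 ?normal_peak_ge0.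
  rewrite !normal_pdfE// /C/=.
  rewrite [leRHS](_ : _ = `|s| * normal_peak s * normal_fun m s' y); last first.
    by field; rewrite gt_eqF ?normal_peak_gt0.
  rewrite [leLHS](_ : _ = normal_peak s * (`|y - m| * normal_fun m s y)); last ring.
  rewrite [leRHS](_ : _ = normal_peak s * (`|s| * normal_fun m s' y)); last ring.
  rewrite ler_wpM2l ?normal_peak_ge0//.
  (* [v] is the exponent for [s'] and half the exponent for [s]: one factor [expR (- v)] cancels,
     and what remains is [|y - m| <= |s| * expR v]. *)
  pose v := (y - m) ^+ 2 / (4 * s ^+ 2).
  have -> : normal_fun m s y = expR (- v) * expR (- v).
    by rewrite -expRD; congr expR; rewrite /v; field.
  have -> : normal_fun m s' y = expR (- v).
    rewrite /normal_fun; congr expR; rewrite /v /s' exprMn sqr_sqrtr//; field.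
    done.
  rewrite mulrA ler_wpM2r ?expR_ge0// expRN ler_pdivrMr ?expR_gt0//.
  apply: (@le_trans _ _ (`|s| * (1 + v))); last first.
    by rewrite ler_wpM2l// expR_ge1Dx.
  have -> : v = `|y - m| ^+ 2 / (4 * `|s| ^+ 2) by rewrite !real_normK ?num_real.
  have : 0 < `|s| by rewrite normr_gt0.
  set a := `|s|; set u := `|y - m| => a0.
  (* AM-GM: [u <= a + u^2 / (4 a)] *)
  rewrite -subr_ge0 (_ : _ - _ = (u - 2 * a) ^+ 2 / (4 * a)); last first.
    by field; rewrite gt_eqF.
  by rewrite divr_ge0 ?sqr_ge0// mulr_ge0// ltW.
- under eq_fun do rewrite EFinM.
  by apply: integrableZl => //; exact: integrable_normal_pdf.
Qed.

(** * Gaussian rates, bells and their derivatives *)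

Lemma gaussian_rate_scale (R : realType) (zeta phi : R) :
  rate_scale (@gaussian_rate R) zeta phi = expR (- (phi ^+ 2 / (2 * zeta ^+ 2))).
Proof.
rewrite /rate_scale /gaussian_rate expr_div_n.
rewrite real_normK; last exact: num_real.
by rewrite -mulrA -invfM [_ * 2]mulrC.
Qed.

(** Clears denominators: with [d] a common denominator, it turns the balance
    [kappa * b = zeta ^+ 2 / s2] into a polynomial relation. *)
Lemma subr_div_eq0P (F : fieldType) (x y p q d : F) :
  x - y = (q - p) / d -> d != 0 -> (x = y <-> p = q).
Proof.
move=> xyE d0; split=> [xy|pq].
  apply/esym/eqP; rewrite -subr_eq0 -(divfK d0 (q - p)) -xyE xy subrr.
  by rewrite mul0r.
by apply/eqP; rewrite -subr_eq0 xyE pq subrr mul0r.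
Qed.

(** Amplitude and rate are independent, because in the symmetric case the diffusion term is a
    product of two Gaussians and need not be normalised. *)
Definition bell (R : realType) (K b m x : R) : R :=
  K * expR (- (b * (x - m) ^+ 2)).

Arguments bell {R}.

Lemma bell_gt0 (R : realType) (K b m x : R) : 0 < K -> 0 < bell K b m x.
Proof. by move=> K0; rewrite mulr_gt0 ?expR_gt0. Qed.

#[local] Instance is_derive_bell (R : realType) (K b m x : R) :
  is_derive x 1 (bell K b m) (- (2 * b * (x - m) * bell K b m x)).
Proof.
(* Pointwise operations on functions let instance resolution compute the derivative. *)
pose u := (- (b *: (id - cst m) ^+ 2) : R -> R).
rewrite (_ : bell K b m = K *: (expR \o u)) //.
apply: is_derive_eq; rewrite /bell /u /= !fctE /GRing.scale /=; ring.
Qed.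

#[local] Instance is_derive_mul_bell (R : realType) (a K b m x : R) :
  is_derive x 1 (fun y => a * (y - m) * bell K b m y)
    (a * bell K b m x - 2 * a * b * (x - m) ^+ 2 * bell K b m x).
Proof.
rewrite (_ : (fun y => _) = (a *: (id - cst m)) * bell K b m) //.
apply: is_derive_eq; rewrite !fctE /GRing.scale /=; ring.
Qed.

(** * Convolutions with a Gaussian density *)

Section Convolution.
Variables (R : realType) (zeta sigma varphi : R).
Hypotheses (zeta_gt0 : 0 < zeta) (sigma_gt0 : 0 < sigma).

Let G := rate_scale (@gaussian_rate R) zeta.
Let F := gaussian sigma varphi.
Let s2 := zeta ^+ 2 + sigma ^+ 2.
Let s2_gt0 : 0 < s2. Proof. by rewrite addr_gt0 ?exprn_gt0. Qed.

(** Precisions add in a product of Gaussians: 1/tau^2 = 1/zeta^2 + 1/sigma^2. *)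
Let tau := zeta * sigma / Num.sqrt s2.
Let tau_neq0 : tau != 0.
Proof. by rewrite gt_eqF// divr_gt0 ?mulr_gt0 ?sqrtr_gt0. Qed.

(** The average of [x] and [varphi] weighted by the precisions 1/zeta^2 and 1/sigma^2. *)
Let mean x := (sigma ^+ 2 * x + zeta ^+ 2 * varphi) / s2.

(** The quotient of peaks is zeta / sqrt(s2); in this form it cancels against the peak of
    [normal_pdf (mean x) tau]. *)
Definition gaussian_mass x :=
  normal_peak sigma / normal_peak tau
  * expR (- ((x - varphi) ^+ 2 / (2 * s2))).

Lemma gaussian_mass_gt0 x : 0 < gaussian_mass x.
Proof.
by rewrite mulr_gt0 ?expR_gt0// divr_gt0// normal_peak_gt0// ?tau_neq0// gt_eqF.
Qed.

Lemma gaussian_mulE x y : G (x - y) * F y =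
  gaussian_mass x * normal_pdf (mean x) tau y.
Proof.
rewrite /G gaussian_rate_scale /F gaussianE// !normal_pdfE ?tau_neq0 ?gt_eqF//.
rewrite /gaussian_mass/= [RHS]mulrACA divfK ?gt_eqF ?normal_peak_gt0//.
rewrite [LHS]mulrCA; congr (_ * _); rewrite /normal_fun -!expRD; congr expR.
rewrite /tau !exprMn exprVn sqr_sqrtr ?ltW// /mean.
have := s2_gt0; rewrite /s2 => h.
by field; rewrite !gt_eqF.
Qed.

Lemma integrable_rate_scale x :
  lebesgue_measure.-integrable [set: R] (fun y => (G (x - y) * F y)%:E).
Proof.
under eq_fun do rewrite gaussian_mulE EFinM.
by apply: integrableZl => //; exact: integrable_normal_pdf.
Qed.

Lemma convol_rate_scale x : convol G F x = gaussian_mass x.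
Proof.
rewrite /convol; under eq_Rintegral do rewrite gaussian_mulE.
rewrite RintegralZl//; last exact: integrable_normal_pdf.
by rewrite /Rintegral integral_normal_pdf/= mulr1.
Qed.

Let M := rate_moment (@gaussian_rate R) zeta.

(** Split x - y as (x - mean x) - (y - mean x), where x - mean x = (zeta^2 / s2) (x - varphi); the
    second part is odd about [mean x] and will integrate to zero. *)
Lemma gaussian_moment_mulE x y : M (x - y) * F y =
  zeta ^+ 2 / s2 * (x - varphi) * (G (x - y) * F y)
  - gaussian_mass x * ((y - mean x) * normal_pdf (mean x) tau y).
Proof.
rewrite /M /rate_moment -/(G _) -mulrA gaussian_mulE /mean.
have := s2_gt0; rewrite /s2 => h.
by field; rewrite !gt_eqF.
Qed.

Lemma integrable_rate_moment x :
  lebesgue_measure.-integrable [set: R] (fun y => (M (x - y) * F y)%:E).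
Proof.
under eq_fun do rewrite gaussian_moment_mulE EFinB EFinM (EFinM (gaussian_mass x)).
apply: integrableB => //; apply: integrableZl => //.
  exact: integrable_rate_scale.
exact: integrable_normal_moment.
Qed.

Lemma convol_rate_moment x :
  convol M F x = zeta ^+ 2 / s2 * (x - varphi) * gaussian_mass x.
Proof.
rewrite /convol; under eq_Rintegral do rewrite gaussian_moment_mulE.
have iG := integrable_rate_scale x.
have iN := integrable_normal_moment _ (mean x) _ tau_neq0.
rewrite RintegralB//; last 2 first.
- by apply: (integrableZl measurableT _ iG).
- by apply: (integrableZl measurableT _ iN).
rewrite !RintegralZl// -/(convol G F x) convol_rate_scale.
rewrite (@Rintegral_odd _ (2 * mean x))//; last first.
  move=> y; rewrite normal_pdfE// /normal_fun.
  rewrite (_ : 2 * mean x - y - mean x = - (y - mean x)); last ring.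
  by rewrite sqrrN mulNr.
by rewrite mulr0 subr0.
Qed.

(** * Equilibrium criterion common to both cases *)

Section Equilibrium.
Variables (gamma kappa K b : R) (H : R -> R).
Hypotheses (gamma_gt0 : 0 < gamma) (K_gt0 : 0 < K).
Hypothesis H_neq0 : forall x, H (gaussian_mass x) != 0.

Let E := bell K b varphi.
(** Apart from [H_neq0], the choice of [H] enters only here, each case supplying its own [K] and
    [b]. *)
Hypothesis diffusionE :
  forall x, gaussian_mass x / H (gaussian_mass x) * F x = E x.

Lemma fp_diffusion_bell : fp_diffusion (@gaussian_rate R) H zeta F = E.
Proof. by apply/funext => x; rewrite /fp_diffusion convol_rate_scale. Qed.

Lemma fp_flux_bell : fp_flux (@gaussian_rate R) H kappa zeta F =
  fun x => (zeta ^+ 2 / s2 - kappa * b) * (x - varphi) * E x.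
Proof.
apply/funext => x; rewrite /fp_flux fp_diffusion_bell derive1E.
rewrite (derive_val (is_derive := is_derive_bell _ K b varphi x)).
rewrite /fp_drift convol_rate_scale convol_rate_moment.
rewrite -/(E x) -!diffusionE; field.
by rewrite H_neq0 gt_eqF.
Qed.

Lemma gaussian_equilibriumP :
  equilibrium (@gaussian_rate R) H gamma kappa zeta F <->
  kappa * b = zeta ^+ 2 / s2.
Proof.
split=> [[_ _ /(_ varphi)]|kb].
  (* At the centre [varphi] the quadratic term of the derivative vanishes, and [gamma] and [K] can
     be divided out. *)
  rewrite /fokker_planck fp_flux_bell derive1E.
  rewrite (derive_val (is_derive := is_derive_mul_bell _ _ K b varphi varphi)).
  rewrite subrr expr0n mulr0 mul0r subr0 => /eqP.
  rewrite mulf_eq0 (gt_eqF gamma_gt0) mulf_eq0.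
  rewrite (gt_eqF (bell_gt0 _ _ b _ _ K_gt0)) orbF subr_eq0.
  by move=> /eqP.
split.
- split.
  + by rewrite /F gaussianE//; exact: measurable_normal_pdf.
  + by move=> x; rewrite /F gaussianE// normal_pdf_ge0.
  + by rewrite /F gaussianE// integral_normal_pdf.
- split.
  + exact: integrable_rate_scale.
  + exact: integrable_rate_moment.
  + by move=> x; rewrite convol_rate_scale.
  + by move=> x; rewrite fp_diffusion_bell; apply: ex_derive.
  + by move=> x; rewrite fp_flux_bell; apply: ex_derive.
(* Under the balance the flux itself vanishes identically, not only its derivative. *)
- move=> x; rewrite /fokker_planck fp_flux_bell kb subrr.
  rewrite (_ : (fun _ => _) = cst 0) ?derive1_cst ?mulr0//.
  by apply/funext => y; rewrite !mul0r.
Qed.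

End Equilibrium.

(** * The symmetric and non-symmetric cases *)

Lemma equilibrium_symmetricP (gamma kappa : R) (H : R -> R) :
  0 < gamma -> symmetric_case H ->
  equilibrium (@gaussian_rate R) H gamma kappa zeta F <->
  sigma ^+ 2 * (2 * (zeta ^+ 2 - kappa)) = kappa * zeta ^+ 2.
Proof.
move=> gamma0 H1; have mass_ge0 x := ltW (gaussian_mass_gt0 x).
(* Here [E] is the product of [gaussian_mass] and [F], so their rates add. *)
pose b := (2 * s2)^-1 + (2 * sigma ^+ 2)^-1.
have balanceE : kappa * b - zeta ^+ 2 / s2 =
    (kappa * zeta ^+ 2 - sigma ^+ 2 * (2 * (zeta ^+ 2 - kappa)))
    / (2 * sigma ^+ 2 * s2).
  have := s2_gt0; rewrite /b /s2 => ?.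
  by field; rewrite !gt_eqF.
apply: (@iff_trans _ _ _ _ (subr_div_eq0P _ _ _ _ _ _ balanceE _)); last first.
  by rewrite !mulf_neq0 ?gt_eqF ?exprn_gt0.
apply: (@gaussian_equilibriumP _ _
  (normal_peak sigma / normal_peak tau * normal_peak sigma)) => //.
  by rewrite mulr_gt0 ?divr_gt0 // normal_peak_gt0 ?tau_neq0 ?gt_eqF.
- by move=> x; rewrite H1 ?oner_eq0.
- move=> x; rewrite H1// divr1 /F gaussianE// normal_pdfE ?gt_eqF//=.
  rewrite /gaussian_mass mulrACA /bell /normal_fun -expRD /b; congr (_ * expR _).
  by field; rewrite !gt_eqF.
Qed.

Lemma equilibrium_nonsymmetricP (gamma kappa : R) (H : R -> R) :
  0 < gamma -> nonsymmetric_case H ->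
  equilibrium (@gaussian_rate R) H gamma kappa zeta F <->
  sigma ^+ 2 * (2 * zeta ^+ 2 - kappa) = kappa * zeta ^+ 2.
Proof.
move=> gamma0 Hid; have mass_gt0 := gaussian_mass_gt0.
(* Here the mass cancels against [H], and [E] is [F] itself. *)
pose b := (2 * sigma ^+ 2)^-1.
have balanceE : kappa * b - zeta ^+ 2 / s2 =
    (kappa * zeta ^+ 2 - sigma ^+ 2 * (2 * zeta ^+ 2 - kappa))
    / (2 * sigma ^+ 2 * s2).
  have := s2_gt0; rewrite /b /s2 => ?.
  by field; rewrite !gt_eqF.
apply: (@iff_trans _ _ _ _ (subr_div_eq0P _ _ _ _ _ _ balanceE _)); last first.
  by rewrite !mulf_neq0 ?gt_eqF ?exprn_gt0.
apply: (@gaussian_equilibriumP _ _ (normal_peak sigma)) => //.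
- by rewrite normal_peak_gt0 ?gt_eqF.
- by move=> x; rewrite Hid ?gt_eqF ?ltW.
- move=> x; rewrite Hid ?ltW// divff ?gt_eqF// mul1r.
  rewrite /F gaussianE// normal_pdfE ?gt_eqF//= /bell /normal_fun /b; congr (_ * expR _).
  by field; rewrite !gt_eqF.
Qed.

End Convolution.

Theorem proposition3p2 (R : realType) (gamma kappa zeta : R) (H : R -> R)
    (hgamma : 0 < gamma) (hkappa : 0 < kappa) (hzeta : 0 < zeta) :
  (forall phi : R,
     rate_scale (@gaussian_rate R) zeta phi
     = expR (- (phi ^+ 2 / (2 * zeta ^+ 2)))) /\
  (symmetric_case H ->
     (forall sigma varphi : R, 0 < sigma -> sigma ^+ 2 = sigma2_s kappa zeta ->
        equilibrium (@gaussian_rate R) H gamma kappa zeta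
          (gaussian sigma varphi)) /\
     ((exists sigma varphi : R, 0 < sigma /\
         equilibrium (@gaussian_rate R) H gamma kappa zeta
           (gaussian sigma varphi)) ->
      kappa < kappa_cs zeta)) /\
  (nonsymmetric_case H ->
     (forall sigma varphi : R, 0 < sigma -> sigma ^+ 2 = sigma2_a kappa zeta ->
        equilibrium (@gaussian_rate R) H gamma kappa zeta
          (gaussian sigma varphi)) /\
     ((exists sigma varphi : R, 0 < sigma /\
         equilibrium (@gaussian_rate R) H gamma kappa zeta
           (gaussian sigma varphi)) ->
      kappa < kappa_ca zeta)).
Proof.
split; first exact: gaussian_rate_scale.
have zeta2_gt0 : 0 < zeta ^+ 2 by rewrite exprn_gt0.
have sigma2E (sigma d : R) : 0 < sigma -> sigma ^+ 2 = zeta ^+ 2 / d ->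
    sigma ^+ 2 * (kappa * d) = kappa * zeta ^+ 2.
  move=> sigma0 sE; have d0 : d != 0.
    (* If [d] were zero, the default value of division would make [sigma ^+ 2] zero. *)
    apply: contraTneq (exprn_gt0 2 sigma0) => d0.
    by rewrite sE d0 invr0 mulr0 ltxx.
  by rewrite sE mulrCA divfK.
(* In both cases [d] is a positive multiple of the gap between the critical value and [kappa], so
   its sign gives the threshold. *)
have kappa_lt (sigma d : R) : 0 < sigma ->
    sigma ^+ 2 * d = kappa * zeta ^+ 2 -> 0 < d.
  move=> sigma0 sE; rewrite -(pmulr_rgt0 _ (exprn_gt0 2 sigma0)) sE.
  by rewrite mulr_gt0.
split=> hH; split.
- move=> sigma varphi sigma0 /sigma2E => /(_ sigma0) sE.
  apply/equilibrium_symmetricP => //; rewrite -sE; congr (_ * _).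
  by field; rewrite gt_eqF.
- move=> [sigma [varphi [sigma0]]] /equilibrium_symmetricP.
  move=> /(_ hzeta sigma0 hgamma hH) /(kappa_lt _ _ sigma0).
  by rewrite /kappa_cs pmulr_rgt0// subr_gt0.
- move=> sigma varphi sigma0 /sigma2E => /(_ sigma0) sE.
  apply/equilibrium_nonsymmetricP => //; rewrite -sE; congr (_ * _).
  by field; rewrite gt_eqF.
- move=> [sigma [varphi [sigma0]]] /equilibrium_nonsymmetricP.
  move=> /(_ hzeta sigma0 hgamma hH) /(kappa_lt _ _ sigma0).
  by rewrite /kappa_ca subr_gt0.
Qed.
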